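(* The number $x'_A=-x_J$ is algebraic with minimal polynomial $P_{x_A}=-830376562500 + 1358127000000 x^2 - 34144387143750 x^4 + 96857243056800 x^6 - 68697978132015 x^8 - 189712941147 x^{10} + 6188723588664 x^{12} - 704220643376 x^{14} - 52577813248 x^{16} + 27196394496 x^{18} - 2918612992 x^{20} + 106774528 x^{22}$ (it vanishes at $x'_A$ and is irreducible over $\mathbb Q$).
   Context: Consider real numbers $t,T$ and points $A=(0,0)$, $B=(t,T)$, $C=(2t,0)$ and $P=(x_P,y_P)$ for $P\in\{D,E,F,G,H,J\}$ satisfying the system $t^2+T^2=1$; $-t(x_D-2t)+T y_D=\tfrac32$; $(x_D-2t)^2+y_D^2=9$; $t(x_E-t)-T(y_E-T)+1=0$; $(x_E-t)^2+(y_E-T)^2=4$; $x_F^2+y_F^2=1$; $|E-F|^2=1$; $|F-G|^2=1$; $|D-G|^2=4$; $|D-H|^2=4$; $|G-H|^2=4$; $|F-J|^2=1$; $|G-J|^2=1$; $x_H=x_J$. Fix the real solution with $t\approx0.992685948824186$, $T\approx0.120725337054926$, $D\approx(0.809996600722107,\,2.760161754567202)$, $E\approx(0.209102417540010,\,1.960833173433061)$, $F\approx(-0.061398137844065,\,0.998113354619244)$, $G\approx(-0.838419516770942,\,1.627587561152422)$, $H\approx(-0.995049481192288,\,3.621444891616507)$, $J\approx(-0.995049481192288,\,0.639930204451542)$. These points are the essential vertices of one quarter of the Harborth graph, whose center of symmetry is $K=(x_J,0)$. In the coordinate system centered at $K$ with axes the symmetry axes, the $x$-coordinate of a point $P$ is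 $x'_P=x_P-x_J$ (the $y$-coordinates are unchanged); in particular $x'_A=-x_J$. *)

(* Defs.v *)
From mathcomp Require Import all_boot all_order all_algebra.
From mathcomp Require Import reals.

Set Implicit Arguments.
Unset Strict Implicit.
Unset Printing Implicit Defensive.

Import Order.TTheory GRing.Theory Num.Theory.

Local Open Scope ring_scope.

(* The large numerals below are kept folded as [Nat.of_num_uint _]; they must  *)
(* not be evaluated to unary numbers.                                          *)
Set Warnings "-abstract-large-number".

Section Harborth.

Variable R : realType.

Implicit Types (t T : R) (P Q D E F G H J : R * R).

Definition sqdist P Q : R := (P.1 - Q.1) ^+ 2 + (P.2 - Q.2) ^+ 2.

Definition harborth_system t T D E F G H J : Prop :=
  t ^+ 2 + T ^+ 2 = 1 /\
  - t * (D.1 - 2 * t) + T * D.2 = 3 / 2 /\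
  (D.1 - 2 * t) ^+ 2 + D.2 ^+ 2 = 9 /\
  t * (E.1 - t) - T * (E.2 - T) + 1 = 0 /\
  (E.1 - t) ^+ 2 + (E.2 - T) ^+ 2 = 4 /\
  F.1 ^+ 2 + F.2 ^+ 2 = 1 /\
  sqdist E F = 1 /\
  sqdist F G = 1 /\
  sqdist D G = 4 /\
  sqdist D H = 4 /\
  sqdist G H = 4 /\
  sqdist F J = 1 /\
  sqdist G J = 1 /\
  H.1 = J.1.

(* x agrees with a decimal of 15 fractional digits, up to one unit in the last *)
(* place.                                                                      *)
Definition approx15 (x a : R) : Prop := `|x - a| <= 1 / 10 ^+ 15.

Definition dec15 (n : nat) : R := n%:R / 10 ^+ 15.

Definition harborth_approx t T D E F G H J : Prop :=
  approx15 t (dec15 992685948824186) /\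
  approx15 T (dec15 120725337054926) /\
  approx15 D.1 (dec15 809996600722107) /\
  approx15 D.2 (dec15 2760161754567202) /\
  approx15 E.1 (dec15 209102417540010) /\
  approx15 E.2 (dec15 1960833173433061) /\
  approx15 F.1 (- dec15 61398137844065) /\
  approx15 F.2 (dec15 998113354619244) /\
  approx15 G.1 (- dec15 838419516770942) /\
  approx15 G.2 (dec15 1627587561152422) /\
  approx15 H.1 (- dec15 995049481192288) /\
  approx15 H.2 (dec15 3621444891616507) /\
  approx15 J.1 (- dec15 995049481192288) /\
  approx15 J.2 (dec15 639930204451542).

Definition ptA : R * R := (0, 0).

(* The x-coordinate of P in the coordinate system centered at K = (x_J, 0). *)
Definition centered_x J P : R := P.1 - J.1.

End Harborth.

Definition P_xA : {poly rat} :=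
    - 830376562500%:R%:P
    + 1358127000000%:R *: 'X^2
    - 34144387143750%:R *: 'X^4
    + 96857243056800%:R *: 'X^6
    - 68697978132015%:R *: 'X^8
    - 189712941147%:R *: 'X^10
    + 6188723588664%:R *: 'X^12
    - 704220643376%:R *: 'X^14
    - 52577813248%:R *: 'X^16
    + 27196394496%:R *: 'X^18
    - 2918612992%:R *: 'X^20
    + 106774528%:R *: 'X^22.

(* p is a minimal polynomial of x over Q, up to a nonzero scalar: P_xA is       *)
(* normalized to be primitive over Z and not monic.                             *)
Definition minimal_poly_rat (R : realType) (x : R) (p : {poly rat}) : Prop :=
  root (map_poly ratr p) x /\ irreducible_poly p.

(* Main.v *)
Require Import Defs.
From Stdlib Require Import ZArith.
From mathcomp Require Import all_boot all_order all_algebra all_field.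
From mathcomp Require Import boolp reals lra ring zify ssrZ.
From mathcomp.algebra_tactics Require common.

(** All coordinates lie in the field generated by sqrt 3 and x = x'_A.  With
    w = x^2 a root of q (where P_xA(X) = q(X^2)), every abscissa has the form
    x N(w) / (30 q'(w)) and every ordinate the form sqrt 3 x N(w) / (30 q'(w)),
    with N an integer polynomial of degree at most 10; the polynomials N were
    found by lattice reduction from a numerical solution.  Starting from the root
    of P_xA near 0.99505, these formulas solve the system, since each equation is
    a congruence modulo q, and interval evaluation puts the solution close to the
    prescribed decimals.  Since the system is quadratic, the difference d of two
    solutions is annihilated by the Jacobian matrix at their midpoint; near the
    decimals this matrix is invertible, so d = 0 and the given x_J is - x.
    Irreducibility is checked modulo 17: P_xA has no root in a field with 17^d
    elements for 1 <= d <= 11, because X^(17^d) - X is invertible modulo P_xA. *)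

Set Implicit Arguments.
Unset Strict Implicit.
Unset Printing Implicit Defensive.

Import Order.TTheory GRing.Theory Num.Theory.

Local Open Scope ring_scope.

(* Numerals stay folded as [Nat.of_num_uint _]; simplification or a failed
   unification would unfold them to unary. *)
Set Warnings "-abstract-large-number".

(* MathComp binds the key Z to the scope of [int]. *)
Delimit Scope Z_scope with ZZ.

(** * Local uniqueness of the solution *)

Section Uniqueness.
Variable R : realType.
Implicit Types (e m x y : R).

Local Notation micro n := (n%:R / 10 ^+ 6).

(* [x0] approximates both [x] and [x - dx], the values of an unknown in two solutions. *)
Definition close e m x dx x0 := [/\ `|x - x0| <= e, `|x - dx - x0| <= e & `|dx| <= m].

Lemma closeN e m x dx x0 : close e m x dx x0 -> close e m (- x) (- dx) (- x0).
Proof. by case=> h1 h2 h3; split; rewrite -?opprD normrN. Qed.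

Lemma closeB e1 m1 e2 m2 x dx x0 y dy y0 :
    close e1 m1 x dx x0 -> close e2 m2 y dy y0 ->
  close (e1 + e2) (m1 + m2) (x - y) (dx - dy) (x0 - y0).
Proof.
case=> [/ler_normlP[a1 a2] /ler_normlP[a3 a4] /ler_normlP[a5 a6]].
case=> [/ler_normlP[b1 b2] /ler_normlP[b3 b4] /ler_normlP[b5 b6]].
by split; apply/ler_normlP; split; lra.
Qed.

Lemma closeM2 e m x dx x0 :
  close e m x dx x0 -> close (2 * e) (2 * m) (2 * x) (2 * dx) (2 * x0).
Proof.
by case=> h1 h2 h3; split; rewrite -?mulrBr normrM (@ger0_norm _ 2) // ler_pM2l.
Qed.

Lemma closeW e m e' m' x dx x0 :
  e <= e' -> m <= m' -> close e m x dx x0 -> close e' m' x dx x0.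
Proof. by move=> le_e le_m [h1 h2 h3]; split; apply: le_trans le_e || apply: le_trans le_m. Qed.

(** Subtracting the two equations gives [a1 * q1 + (b1 - q1) * p1 + a2 * q2 + (b2 - q2) * p2 = 0]
    exactly: with one factor taken from each solution there is no second-order term. Replacing [a1]
    by [u1] and [b1 - q1] by [v1], and likewise for index 2, costs four errors of at most
    [e * m]. *)
Lemma bilinear_linearization e m a1 b1 a2 b2 p1 q1 p2 q2 u1 v1 u2 v2 (k : R) :
    close e m a1 p1 u1 -> close e m b1 q1 v1 -> close e m a2 p2 u2 -> close e m b2 q2 v2 ->
    a1 * b1 + a2 * b2 = k -> (a1 - p1) * (b1 - q1) + (a2 - p2) * (b2 - q2) = k ->
  `|u1 * q1 + v1 * p1 + (u2 * q2 + v2 * p2)| <= 4 * (e * m).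
Proof.
have mul_le x y : `|x| <= e -> `|y| <= m -> `|x * y| <= e * m.
  by move=> hx hy; rewrite normrM ler_pM.
move=> [ha1 _ hp1] [_ hb1 hq1] [ha2 _ hp2] [_ hb2 hq2] h h'.
have := mul_le _ _ ha1 hq1; have := mul_le _ _ hb1 hp1.
have := mul_le _ _ ha2 hq2; have := mul_le _ _ hb2 hp2.
move=> /ler_normlP[h1 h2] /ler_normlP[h3 h4] /ler_normlP[h5 h6] /ler_normlP[h7 h8].
by apply/ler_normlP; split; lra.
Qed.

Lemma circle_linearization e m x y dx dy x0 y0 (k : R) :
    close e m x dx x0 -> close e m y dy y0 ->
    x ^+ 2 + y ^+ 2 = k -> (x - dx) ^+ 2 + (y - dy) ^+ 2 = k ->
  `|2 * (x0 * dx + y0 * dy)| <= 4 * (e * m).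
Proof.
move=> hx hy h h'.
rewrite (_ : 2 * _ = x0 * dx + x0 * dx + (y0 * dy + y0 * dy)); last by ring.
exact: (bilinear_linearization hx hx hy hy h h').
Qed.

(** The Jacobian matrix of the system at the approximate values, applied to the differences; the
    rows follow the order of [harborth_system]. *)
Definition harborth_linearized (t0 T0 D10 D20 E10 E20 F10 F20 G10 G20 H10 H20 J10 J20
    dt dT dD1 dD2 dE1 dE2 dF1 dF2 dG1 dG2 dH1 dH2 dJ1 dJ2 eps : R) : Prop :=
  `|2 * (t0 * dt + T0 * dT)| <= eps /\
  `|- t0 * (dD1 - 2 * dt) + (D10 - 2 * t0) * (- dt) + (T0 * dD2 + D20 * dT)| <= eps /\
  `|2 * ((D10 - 2 * t0) * (dD1 - 2 * dt) + D20 * dD2)| <= eps /\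
  `|t0 * (dE1 - dt) + (E10 - t0) * dt + (- T0 * (dE2 - dT) + (E20 - T0) * (- dT))| <= eps /\
  `|2 * ((E10 - t0) * (dE1 - dt) + (E20 - T0) * (dE2 - dT))| <= eps /\
  `|2 * (F10 * dF1 + F20 * dF2)| <= eps /\
  `|2 * ((E10 - F10) * (dE1 - dF1) + (E20 - F20) * (dE2 - dF2))| <= eps /\
  `|2 * ((F10 - G10) * (dF1 - dG1) + (F20 - G20) * (dF2 - dG2))| <= eps /\
  `|2 * ((D10 - G10) * (dD1 - dG1) + (D20 - G20) * (dD2 - dG2))| <= eps /\
  `|2 * ((D10 - H10) * (dD1 - dH1) + (D20 - H20) * (dD2 - dH2))| <= eps /\
  `|2 * ((G10 - H10) * (dG1 - dH1) + (G20 - H20) * (dG2 - dH2))| <= eps /\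
  `|2 * ((F10 - J10) * (dF1 - dJ1) + (F20 - J20) * (dF2 - dJ2))| <= eps /\
  `|2 * ((G10 - J10) * (dG1 - dJ1) + (G20 - J20) * (dG2 - dJ2))| <= eps /\
  dH1 = dJ1.

Lemma harborth_linearization e m (t T D1 D2 E1 E2 F1 F2 G1 G2 H1 H2 J1 J2
    dt dT dD1 dD2 dE1 dE2 dF1 dF2 dG1 dG2 dH1 dH2 dJ1 dJ2
    t0 T0 D10 D20 E10 E20 F10 F20 G10 G20 H10 H20 J10 J20 : R) :
    close e m t dt t0 -> close e m T dT T0 ->
    close e m D1 dD1 D10 -> close e m D2 dD2 D20 ->
    close e m E1 dE1 E10 -> close e m E2 dE2 E20 ->
    close e m F1 dF1 F10 -> close e m F2 dF2 F20 ->
    close e m G1 dG1 G10 -> close e m G2 dG2 G20 ->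
    close e m H1 dH1 H10 -> close e m H2 dH2 H20 ->
    close e m J1 dJ1 J10 -> close e m J2 dJ2 J20 ->
    harborth_system t T (D1, D2) (E1, E2) (F1, F2) (G1, G2) (H1, H2) (J1, J2) ->
    harborth_system (t - dt) (T - dT) (D1 - dD1, D2 - dD2) (E1 - dE1, E2 - dE2)
      (F1 - dF1, F2 - dF2) (G1 - dG1, G2 - dG2) (H1 - dH1, H2 - dH2) (J1 - dJ1, J2 - dJ2) ->
  harborth_linearized t0 T0 D10 D20 E10 E20 F10 F20 G10 G20 H10 H20 J10 J20
    dt dT dD1 dD2 dE1 dE2 dF1 dF2 dG1 dG2 dH1 dH2 dJ1 dJ2 (4 * (3 * e * (3 * m))).
Proof.
move=> ct cT cD1 cD2 cE1 cE2 cF1 cF2 cG1 cG2 cH1 cH2 cJ1 cJ2.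
rewrite /harborth_system /sqdist /=.
case=> [q1 [q2 [q3 [q4 [q5 [q6 [q7 [q8 [q9 [q10 [q11 [q12 [q13 q14]]]]]]]]]]]]].
case=> [r1 [r2 [r3 [r4 [r5 [r6 [r7 [r8 [r9 [r10 [r11 [r12 [r13 r14]]]]]]]]]]]]].
have [e0 m0] : 0 <= e /\ 0 <= m.
  by case: ct => h _ h'; split; [apply: le_trans h|apply: le_trans h'].
have w1 x dx x0 : close e m x dx x0 -> close (3 * e) (3 * m) x dx x0.
  by apply: closeW; rewrite ler_peMl ?ler1n.
have wB x dx x0 y dy y0 : close e m x dx x0 -> close e m y dy y0 ->
    close (3 * e) (3 * m) (x - y) (dx - dy) (x0 - y0).
  by move=> hx hy; apply: closeW (closeB hx hy); lra.
(* [D1 - 2 * t] has the largest error, [e + 2 * e]; the factors 3 come from it. *)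
have cD1t : close (3 * e) (3 * m) (D1 - 2 * t) (dD1 - 2 * dt) (D10 - 2 * t0).
  by apply: closeW (closeB cD1 (closeM2 ct)); lra.
have subBB (x dx y dy : R) : x - y - (dx - dy) = x - dx - (y - dy) by ring.
have subBM2 (x dx y dy : R) : x - 2 * y - (dx - 2 * dy) = x - dx - 2 * (y - dy) by ring.
have dist x dx x0 y dy y0 x' dx' x0' y' dy' y0' k :
    close e m x dx x0 -> close e m x' dx' x0' -> close e m y dy y0 -> close e m y' dy' y0' ->
    (x - x') ^+ 2 + (y - y') ^+ 2 = k ->
    (x - dx - (x' - dx')) ^+ 2 + (y - dy - (y' - dy')) ^+ 2 = k ->
    `|2 * ((x0 - x0') * (dx - dx') + (y0 - y0') * (dy - dy'))| <= 4 * (3 * e * (3 * m)).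
  move=> hx hx' hy hy' h h'.
  apply: (circle_linearization (wB _ _ _ _ _ _ hx hx') (wB _ _ _ _ _ _ hy hy') h).
  by rewrite (subBB x) (subBB y).
rewrite /harborth_linearized; do ?[apply: conj].
- exact: (circle_linearization (w1 _ _ _ ct) (w1 _ _ _ cT) q1 r1).
- apply: (bilinear_linearization (closeN (w1 _ _ _ ct)) cD1t (w1 _ _ _ cT) (w1 _ _ _ cD2) q2).
  by rewrite subBM2 -r2; ring.
- by apply: (circle_linearization cD1t (w1 _ _ _ cD2) q3); rewrite subBM2.
- apply: (bilinear_linearization (w1 _ _ _ ct) (wB _ _ _ _ _ _ cE1 ct)
    (closeN (w1 _ _ _ cT)) (wB _ _ _ _ _ _ cE2 cT) (k := -1)); lra.
- exact: (dist _ _ _ _ _ _ _ _ _ _ _ _ _ cE1 ct cE2 cT q5 r5).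
- exact: (circle_linearization (w1 _ _ _ cF1) (w1 _ _ _ cF2) q6 r6).
- exact: (dist _ _ _ _ _ _ _ _ _ _ _ _ _ cE1 cF1 cE2 cF2 q7 r7).
- exact: (dist _ _ _ _ _ _ _ _ _ _ _ _ _ cF1 cG1 cF2 cG2 q8 r8).
- exact: (dist _ _ _ _ _ _ _ _ _ _ _ _ _ cD1 cG1 cD2 cG2 q9 r9).
- exact: (dist _ _ _ _ _ _ _ _ _ _ _ _ _ cD1 cH1 cD2 cH2 q10 r10).
- exact: (dist _ _ _ _ _ _ _ _ _ _ _ _ _ cG1 cH1 cG2 cH2 q11 r11).
- exact: (dist _ _ _ _ _ _ _ _ _ _ _ _ _ cF1 cJ1 cF2 cJ2 q12 r12).
- exact: (dist _ _ _ _ _ _ _ _ _ _ _ _ _ cG1 cJ1 cG2 cJ2 q13 r13).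
- lra.
Qed.

(* Eliminating along the equations expresses each difference as a multiple of [t] up
   to a multiple of [eps]; the last equation [H1 = J1] then bounds [t]. *)
Lemma harborth_linearized_bound (t T D1 D2 E1 E2 F1 F2 G1 G2 H1 H2 J1 J2 eps : R) :
    `|t| <= 3 * 10 ^+ 4 * eps ->
    harborth_linearized (micro 992686) (micro 120725) (micro 809997) (micro 2760162)
      (micro 209102) (micro 1960833) (- micro 61398) (micro 998113)
      (- micro 838420) (micro 1627588) (- micro 995049)
      (micro 3621445) (- micro 995049) (micro 639930)
      t T D1 D2 E1 E2 F1 F2 G1 G2 H1 H2 J1 J2 eps ->
  \sum_(d <- [:: t; T; D1; D2; E1; E2; F1; F2; G1; G2; H1; H2; J1; J2]) `|d| <= 4000 * eps.
Proof.
move=> /ler_normlP[lt ut].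
case=> /ler_normlP[l0 u0].
(* The slope 8.2227 is [t0 / T0] rounded. Here and below, the rounding error of a slope, multiplied
   by [t], is absorbed through the hypothesis [|t| <= 3 * 10 ^ 4 * eps]. *)
have [lT uT] : - 10 * eps <= T - (- micro 8222700) * t /\
  T - (- micro 8222700) * t <= 10 * eps.
  by clear -lt ut l0 u0; split; lra.
clear l0 u0.
case=> /ler_normlP[l1 u1].
case=> /ler_normlP[l2 u2].
have [lD1 uD1] : - 36 * eps <= D1 - (- micro 20863200) * t /\
  D1 - (- micro 20863200) * t <= 36 * eps.
  by clear -lt ut l1 u1 l2 u2 lT uT; split; lra.
have [lD2 uD2] : - 19 * eps <= D2 - (- micro 9735960) * t /\
  D2 - (- micro 9735960) * t <= 19 * eps.
  by clear -lt ut l1 u1 l2 u2 lT uT; split; lra.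
clear l1 u1 l2 u2.
case=> /ler_normlP[l3 u3].
case=> /ler_normlP[l4 u4].
have [lE1 uE1] : - 26 * eps <= E1 - (- micro 14242140) * t /\
  E1 - (- micro 14242140) * t <= 26 * eps.
  by clear -lt ut l3 u3 l4 u4 lT uT; split; lra.
have [lE2 uE2] : - 25 * eps <= E2 - (- micro 14713350) * t /\
  E2 - (- micro 14713350) * t <= 25 * eps.
  by clear -lt ut l3 u3 l4 u4 lT uT; split; lra.
clear l3 u3 l4 u4.
case=> /ler_normlP[l5 u5].
case=> /ler_normlP[l6 u6].
have [lF1 uF1] : - 103 * eps <= F1 - (- micro 54644210) * t /\
  F1 - (- micro 54644210) * t <= 103 * eps.
  by clear -lt ut l5 u5 l6 u6 lE1 uE1 lE2 uE2; split; lra.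
have [lF2 uF2] : - 12 * eps <= F2 - (- micro 3361390) * t /\
  F2 - (- micro 3361390) * t <= 12 * eps.
  by clear -lt ut l5 u5 l6 u6 lE1 uE1 lE2 uE2; split; lra.
clear l5 u5 l6 u6.
case=> /ler_normlP[l7 u7].
case=> /ler_normlP[l8 u8].
have [lG1 uG1] : - 84 * eps <= G1 - (- micro 38735430) * t /\
  G1 - (- micro 38735430) * t <= 84 * eps.
  by clear -lt ut l7 u7 l8 u8 lD1 uD1 lD2 uD2 lF1 uF1 lF2 uF2; split; lra.
have [lG2 uG2] : - 114 * eps <= G2 - micro 16276360 * t /\
  G2 - micro 16276360 * t <= 114 * eps.
  by clear -lt ut l7 u7 l8 u8 lD1 uD1 lD2 uD2 lF1 uF1 lF2 uF2; split; lra.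
clear l7 u7 l8 u8.
case=> /ler_normlP[l9 u9].
case=> /ler_normlP[l10 u10].
have [lH1 uH1] : - 113 * eps <= H1 - (- micro 7272000) * t /\
  H1 - (- micro 7272000) * t <= 113 * eps.
  by clear -lt ut l9 u9 l10 u10 lD1 uD1 lD2 uD2 lG1 uG1 lG2 uG2; split; lra.
have [lH2 uH2] : - 135 * eps <= H2 - micro 18747990 * t /\
  H2 - micro 18747990 * t <= 135 * eps.
  by clear -lt ut l9 u9 l10 u10 lD1 uD1 lD2 uD2 lG1 uG1 lG2 uG2; split; lra.
clear l9 u9 l10 u10.
case=> /ler_normlP[l11 u11].
case=> /ler_normlP[l12 u12] HJ.
have [lJ1 uJ1] : - 173 * eps <= J1 - (- micro 63696600) * t /\
  J1 - (- micro 63696600) * t <= 173 * eps.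
  by clear -lt ut l11 u11 l12 u12 lF1 uF1 lF2 uF2 lG1 uG1 lG2 uG2; split; lra.
have [lJ2 uJ2] : - 160 * eps <= J2 - micro 20234860 * t /\
  J2 - micro 20234860 * t <= 160 * eps.
  by clear -lt ut l11 u11 l12 u12 lF1 uF1 lF2 uF2 lG1 uG1 lG2 uG2; split; lra.
clear l11 u11 l12 u12.
(* The slopes of [H1] and [J1] in [t] differ by more than 56, so [H1 = J1] gives
   [|t| <= (113 + 173) * eps / 56]. *)
have [lt' ut'] : - 7 * eps <= t /\ t <= 7 * eps
  by clear -lt ut HJ lH1 uH1 lJ1 uJ1; split; lra.
have bt : `|t| <= 7 * eps by clear -lt' ut'; apply/ler_normlP; split; lra.
have bT : `|T| <= 68 * eps by clear -lt' ut' lT uT; apply/ler_normlP; split; lra.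
have bD1 : `|D1| <= 183 * eps by clear -lt' ut' lD1 uD1; apply/ler_normlP; split; lra.
have bD2 : `|D2| <= 88 * eps by clear -lt' ut' lD2 uD2; apply/ler_normlP; split; lra.
have bE1 : `|E1| <= 126 * eps by clear -lt' ut' lE1 uE1; apply/ler_normlP; split; lra.
have bE2 : `|E2| <= 128 * eps by clear -lt' ut' lE2 uE2; apply/ler_normlP; split; lra.
have bF1 : `|F1| <= 486 * eps by clear -lt' ut' lF1 uF1; apply/ler_normlP; split; lra.
have bF2 : `|F2| <= 36 * eps by clear -lt' ut' lF2 uF2; apply/ler_normlP; split; lra.
have bG1 : `|G1| <= 356 * eps by clear -lt' ut' lG1 uG1; apply/ler_normlP; split; lra.
have bG2 : `|G2| <= 228 * eps by clear -lt' ut' lG2 uG2; apply/ler_normlP; split; lra.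
have bH1 : `|H1| <= 164 * eps by clear -lt' ut' lH1 uH1; apply/ler_normlP; split; lra.
have bH2 : `|H2| <= 267 * eps by clear -lt' ut' lH2 uH2; apply/ler_normlP; split; lra.
have bJ1 : `|J1| <= 619 * eps by clear -lt' ut' lJ1 uJ1; apply/ler_normlP; split; lra.
have bJ2 : `|J2| <= 302 * eps by clear -lt' ut' lJ2 uJ2; apply/ler_normlP; split; lra.
rewrite !big_cons big_nil.
by clear -bt bT bD1 bD2 bE1 bE2 bF1 bF2 bG1 bG2 bH1 bH2 bJ1 bJ2 lt' ut'; lra.
Qed.

(** The centers are the prescribed values rounded to six decimals, the point at which the Jacobian
    matrix is taken. *)
Definition harborth_near e (t T : R) (D E F G H J : R * R) : Prop :=
  `|t - micro 992686| <= e /\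
  `|T - micro 120725| <= e /\
  `|D.1 - micro 809997| <= e /\
  `|D.2 - micro 2760162| <= e /\
  `|E.1 - micro 209102| <= e /\
  `|E.2 - micro 1960833| <= e /\
  `|F.1 - (- micro 61398)| <= e /\
  `|F.2 - micro 998113| <= e /\
  `|G.1 - (- micro 838420)| <= e /\
  `|G.2 - micro 1627588| <= e /\
  `|H.1 - (- micro 995049)| <= e /\
  `|H.2 - micro 3621445| <= e /\
  `|J.1 - (- micro 995049)| <= e /\
  `|J.2 - micro 639930| <= e.

(** The sum [m] of all absolute differences bounds each of them, so the linearized equations hold
    with an error proportional to [m], and they bound [m] by a fraction of itself. *)
Lemma harborth_unique (t T : R) D E F G H J t' T' D' E' F' G' H' J' :
    harborth_system t T D E F G H J -> harborth_system t' T' D' E' F' G' H' J' ->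
    harborth_near (10 ^- 6) t T D E F G H J ->
    harborth_near (10 ^- 6) t' T' D' E' F' G' H' J' ->
  J.1 = J'.1.
Proof.
case: D E F G H J => [D1 D2] [E1 E2] [F1 F2] [G1 G2] [H1 H2] [J1 J2].
case: D' E' F' G' H' J' => [D1' D2'] [E1' E2'] [F1' F2'] [G1' G2'] [H1' H2'] [J1' J2'].
move=> sys sys'; rewrite /harborth_near; cbn [fst snd].
case=> [nt [nT [nD1 [nD2 [nE1 [nE2 [nF1 [nF2 [nG1 [nG2 [nH1 [nH2 [nJ1 nJ2]]]]]]]]]]]]].
case=> [ot [oT [oD1 [oD2 [oE1 [oE2 [oF1 [oF2 [oG1 [oG2 [oH1 [oH2 [oJ1 oJ2]]]]]]]]]]]]].
pose ds := [:: t - t'; T - T'; D1 - D1'; D2 - D2'; E1 - E1'; E2 - E2'; F1 - F1'; F2 - F2';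
  G1 - G1'; G2 - G2'; H1 - H1'; H2 - H2'; J1 - J1'; J2 - J2'].
pose m := \sum_(d <- ds) `|d|.
have le_m d : d \in ds -> `|d| <= m.
  by move=> din; rewrite /m (big_rem d) //= lerDl; apply: sumr_ge0 => *.
have near_close (x x' x0 : R) : `|x - x0| <= 10 ^- 6 -> `|x' - x0| <= 10 ^- 6 ->
    `|x - x'| <= m -> close (10 ^- 6) m x (x - x') x0.
  by move=> h h' hm; split=> //; rewrite subKr.
have mt : `|t - t'| <= m by apply: le_m; rewrite !inE eqxx ?orbT.
have mT : `|T - T'| <= m by apply: le_m; rewrite !inE eqxx ?orbT.
have mD1 : `|D1 - D1'| <= m by apply: le_m; rewrite !inE eqxx ?orbT.
have mD2 : `|D2 - D2'| <= m by apply: le_m; rewrite !inE eqxx ?orbT.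
have mE1 : `|E1 - E1'| <= m by apply: le_m; rewrite !inE eqxx ?orbT.
have mE2 : `|E2 - E2'| <= m by apply: le_m; rewrite !inE eqxx ?orbT.
have mF1 : `|F1 - F1'| <= m by apply: le_m; rewrite !inE eqxx ?orbT.
have mF2 : `|F2 - F2'| <= m by apply: le_m; rewrite !inE eqxx ?orbT.
have mG1 : `|G1 - G1'| <= m by apply: le_m; rewrite !inE eqxx ?orbT.
have mG2 : `|G2 - G2'| <= m by apply: le_m; rewrite !inE eqxx ?orbT.
have mH1 : `|H1 - H1'| <= m by apply: le_m; rewrite !inE eqxx ?orbT.
have mH2 : `|H2 - H2'| <= m by apply: le_m; rewrite !inE eqxx ?orbT.
have mJ1 : `|J1 - J1'| <= m by apply: le_m; rewrite !inE eqxx ?orbT.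
have mJ2 : `|J2 - J2'| <= m by apply: le_m; rewrite !inE eqxx ?orbT.
have := @harborth_linearization (10 ^- 6) m t T D1 D2 E1 E2 F1 F2 G1 G2 H1 H2 J1 J2
  (t - t') (T - T') (D1 - D1') (D2 - D2') (E1 - E1') (E2 - E2') (F1 - F1') (F2 - F2')
  (G1 - G1') (G2 - G2') (H1 - H1') (H2 - H2') (J1 - J1') (J2 - J2')
  _ _ _ _ _ _ _ _ _ _ _ _ _ _
  (near_close _ _ _ nt ot mt)
  (near_close _ _ _ nT oT mT)
  (near_close _ _ _ nD1 oD1 mD1)
  (near_close _ _ _ nD2 oD2 mD2)
  (near_close _ _ _ nE1 oE1 mE1)
  (near_close _ _ _ nE2 oE2 mE2)
  (near_close _ _ _ nF1 oF1 mF1)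
  (near_close _ _ _ nF2 oF2 mF2)
  (near_close _ _ _ nG1 oG1 mG1)
  (near_close _ _ _ nG2 oG2 mG2)
  (near_close _ _ _ nH1 oH1 mH1)
  (near_close _ _ _ nH2 oH2 mH2)
  (near_close _ _ _ nJ1 oJ1 mJ1)
  (near_close _ _ _ nJ2 oJ2 mJ2)
  sys.
rewrite !subKr => /(_ sys') /harborth_linearized_bound.
rewrite -/ds -/m => bound.
(* Here [eps] is [36 * 10 ^- 6 * m]: the a priori bound on [|t - t'|] holds since
   [3 * 10 ^ 4 * eps = 1.08 * m], and the conclusion reads [m <= 0.144 * m]. *)
have m_le0 : m <= 0.
  have : m <= 4000 * (4 * (3 * 10 ^- 6 * (3 * m))).
    by apply: bound; apply: (le_trans mt); have := le_trans (normr_ge0 _) mt; clear; lra.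
  by clear; lra.
by apply/eqP; rewrite -subr_eq0 -normr_le0 (le_trans mJ1).
Qed.
End Uniqueness.

(** * Irreducibility by reduction modulo a prime *)

Lemma exists_irreducible_divisor (F : fieldType) (p : {poly F}) :
  (1 < size p)%N -> exists2 h, irreducible_poly h & h %| p.
Proof.
have [n] := ubnP (size p); elim: n p => // n IHn p /ltnSE le_p_n p_gt1.
have [irr_p | red_p] := EM (irreducible_poly p); first by exists p.
have [q [q_neq1 q_dvd q_neqp]] : exists q : {poly F}, [/\ size q != 1, q %| p & ~~ (q %= p)].
  apply: contra_notP red_p => /forallNP red_p; split=> // q q_neq1 q_dvd.
  by apply/negPn/negP => q_neqp; apply: (red_p q).
have p_neq0 : p != 0 by rewrite -size_poly_gt0 (ltn_trans _ p_gt1).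
have q_gt1 : (1 < size q)%N.
  by rewrite ltn_neqAle eq_sym q_neq1 size_poly_gt0 (dvdpN0 q_dvd).
have lt_qp : (size q < size p)%N.
  by rewrite ltn_neqAle (dvdp_leq p_neq0 q_dvd) andbT dvdp_size_eqp.
have [h irr_h h_dvd] := IHn q (leq_trans lt_qp le_p_n) q_gt1.
by exists h => //; apply: dvdp_trans q_dvd.
Qed.

(** Ben-Or's test. A reducible [f] has an irreducible factor of degree d at most half of deg f, and
    a root of it generates a field with [#|F| ^ d] elements, all fixed by the power [#|F| ^ d]. The
    condition [d.*2 < size f] means 2 d <= deg f. *)
Lemma irreducible_poly_finfield (F : finFieldType) (f : {poly F}) :
    (1 < size f)%N ->
    (forall (L : fieldExtType F) (z : L) d,
      root (map_poly (in_alg L) f) z -> (0 < d)%N -> (d.*2 < size f)%N ->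
      z ^+ (#|F| ^ d) != z) ->
  irreducible_poly f.
Proof.
move=> f_gt1 no_root.
have f_neq0 : f != 0 by rewrite -size_poly_gt0 (ltn_trans _ f_gt1).
(* Every nonconstant divisor has degree greater than half of deg f, so two complementary ones cannot
   coexist. *)
have small_divisor (g : {poly F}) : (1 < size g)%N -> g %| f -> (size f <= (size g).-1.*2)%N.
  move=> g_gt1 g_dvd; have [h irr_h h_dvd] := exists_irreducible_divisor g_gt1.
  have g_neq0 : g != 0 by rewrite -size_poly_gt0 (ltn_trans _ g_gt1).
  have [L dimL [z hz _]] := irredp_FAdjoin irr_h.
  have fz : root (map_poly (in_alg L) f) z.
    by have /dvdpP[k ->] := dvdp_trans h_dvd g_dvd; rewrite rmorphM rootM hz orbT.
  apply: (@leq_trans (size h).-1.*2); last first.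
    by rewrite leq_double -!subn1 leq_sub2r // dvdp_leq.
  rewrite leqNgt; apply/negP => small.
  have h_gt1 := irr_h.1.
  have d_gt0 : (0 < (size h).-1)%N by case: (size h) h_gt1 => [|[]].
  have /eqP[] := no_root L z _ fz d_gt0 small.
  have card_L : #|{: finvect_type L}| = (#|F| ^ \dim {: finvect_type L})%N.
    by rewrite -card_vspace card_vspacef.
  by rewrite -dimL -[RHS](@expf_card (finvect_type L) z) card_L.
split=> // g g_neq1 g_dvd; rewrite -dvdp_size_eqp //.
have [k fE] := dvdpP _ _ g_dvd.
have [g_neq0 k_neq0] : g != 0 /\ k != 0.
  by move: f_neq0; rewrite fE mulf_eq0 negb_or => /andP[].
have g_gt1 : (1 < size g)%N by rewrite ltn_neqAle eq_sym g_neq1 size_poly_gt0.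
have := small_divisor g g_gt1 g_dvd.
have [k_gt1|k_le1] := ltnP 1 (size k).
  have k_dvd : k %| f by rewrite fE dvdp_mulr.
  have := small_divisor k k_gt1 k_dvd.
  rewrite fE size_mul //; move: (size k) (size g) k_gt1 g_gt1 => [|[|a]] [|[|b]] // _ _.
  by rewrite addSn /= -!addnn; lia.
by rewrite fE size_mul //; move: k_neq0; rewrite -size_poly_gt0; case: (size k) k_le1 => [|[|]].
Qed.

(** By Gauss's lemma a rational divisor of [f] is a multiple of an integer divisor [g]; the leading
    coefficient of [g] divides that of [f], so [g] keeps its degree in [F]. *)
Lemma irreducible_poly_reduction (F : fieldType) (f : {poly int}) :
    (lead_coef f)%:~R != 0 :> F ->
    irreducible_poly (map_poly intr f : {poly F}) ->
  irreducible_poly (map_poly intr f : {poly rat}).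
Proof.
move=> lc_neq0 [].
rewrite size_map_poly_id0 // => f_gt1 irr_f; split=> [|q]; first by rewrite size_rat_int_poly.
move=> + /dvdpP_rat_int[g [a a_neq0 qE] [r fE]]; rewrite qE.
rewrite size_scale // size_rat_int_poly => g_neq1.
have lcg_neq0 : (lead_coef g)%:~R != 0 :> F.
  by apply: contraNneq lc_neq0 => h; rewrite fE lead_coefM intrM h mul0r.
have g_dvd : map_poly intr g %| (map_poly intr f : {poly F}).
  by rewrite fE rmorphM dvdp_mulr.
have := irr_f _ _ g_dvd; rewrite -dvdp_size_eqp // !size_map_poly_id0 //.
move=> /(_ g_neq1) /eqP g_size.
rewrite -dvdp_size_eqp; first by rewrite size_scale // !size_rat_int_poly g_size.
by rewrite dvdpZl // dvdp_rat_int fE dvdp_mulr.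
Qed.

(** * Integer polynomials as lists of binary integers, suited to [vm_compute] *)

Definition zr (A : pzRingType) (z : Z) : A := (int_of_Z z)%:~R.

Arguments zr : simpl never.

Section IntegerPolynomialLists.
Variable A : comNzRingType.
Implicit Types (x : A) (c p : Z) (a b l f : seq Z).

Lemma zrD c p : zr A (c + p) = zr A c + zr A p.
Proof. by rewrite /zr -rmorphD -[in RHS]rmorphD. Qed.

Lemma zrM c p : zr A (c * p) = zr A c * zr A p.
Proof. by rewrite /zr -rmorphM -[in RHS]rmorphM. Qed.

Lemma zrN c : zr A (- c)%ZZ = - zr A c.
Proof. by rewrite /zr -rmorphN -[in RHS]rmorphN. Qed.

Lemma zr0 : zr A 0 = 0. Proof. by []. Qed.

Lemma zr1 : zr A 1 = 1. Proof. by []. Qed.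

Lemma zr_pow10 n : zr A (10 ^ Z.of_nat n) = 10 ^+ n.
Proof.
elim: n => [//|n IHn].
by rewrite exprS -IHn Nat2Z.inj_succ Z.pow_succ_r ?zrM //; lia.
Qed.

Fixpoint evz l x : A := if l is c :: l' then zr A c + x * evz l' x else 0.

Fixpoint zpadd a b : seq Z :=
  match a, b with
  | c :: a', d :: b' => (c + d)%ZZ :: zpadd a' b'
  | [::], _ => b
  | _, [::] => a
  end.

Definition zpscale c a := map (Z.mul c) a.

Definition zpsub a b := zpadd a (zpscale (-1) b).

Fixpoint zpmul a b : seq Z :=
  if a is c :: a' then zpadd (zpscale c b) (0%ZZ :: zpmul a' b) else [::].

(** Drops trailing zeros, so that the zero polynomial becomes [[::]], which the checks test with
    [nilp]. *)
Fixpoint zptrim a : seq Z :=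
  if a is c :: a' then
    if zptrim a' is d :: t then c :: d :: t else if Z.eqb c 0 then [::] else [:: c]
  else [::].

Lemma evz_add a b x : evz (zpadd a b) x = evz a x + evz b x.
Proof.
elim: a b => [|c a IHa] [|d b] /=; rewrite ?add0r ?addr0 //.
by rewrite IHa zrD mulrDr addrACA.
Qed.

Lemma evz_scale c a x : evz (zpscale c a) x = zr A c * evz a x.
Proof. by elim: a => [|d a IHa] /=; rewrite ?mulr0 // IHa zrM mulrDr mulrCA. Qed.

Lemma evz_sub a b x : evz (zpsub a b) x = evz a x - evz b x.
Proof. by rewrite evz_add evz_scale mulN1r. Qed.

Lemma evz_mul a b x : evz (zpmul a b) x = evz a x * evz b x.
Proof.
elim: a => [|c a IHa] /=; first by rewrite mul0r.
by rewrite evz_add evz_scale /= zr0 add0r IHa mulrDl mulrA.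
Qed.

Lemma evz_trim a x : evz (zptrim a) x = evz a x.
Proof.
elim: a => [//|c a /= <-]; case: (zptrim a) => [|//].
by case: Z.eqb_spec => [->|_] /=; rewrite ?zr0 mulr0 ?addr0.
Qed.

Lemma horner_Poly_evz l x : (Poly (map (zr A) l)).[x] = evz l x.
Proof. by rewrite horner_Poly; elim: l => //= c l ->; rewrite addrC mulrC. Qed.

Section Modular.
Variables (p : Z) (f : seq Z).

Definition zpred a := zptrim (map (Z.modulo^~ p) a).

(* Long division of [l] by the monic [f]; only the quotient is used, and the
   reduction [a - q * f] below preserves values at roots of [f] whatever [q] is. *)
Fixpoint zpdivmod l : seq Z * seq Z :=
  if l is c :: l' then
    let: (q, r) := zpdivmod l' in
    let r1 := c :: r in
    let t := nth 0%ZZ r1 (size f).-1 in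
    (t :: q, take (size f).-1 (map (Z.modulo^~ p) (zpsub r1 (zpscale t f))))
  else ([::], [::]).

Definition zpmulmod a b :=
  let s := zpmul a b in zpred (zpsub s (zpmul (zpred (zpdivmod s).1) f)).

Definition zpexpmod a n := iter n (zpmulmod a) [:: 1%ZZ].

(* [r] stands for X^(p^k) modulo [f], and each certificate in [vs] is an inverse
   modulo [f] of X^(p^(k+1)) - X, X^(p^(k+2)) - X, ... *)
Fixpoint ben_or_check r vs : bool :=
  if vs is v :: vs' then
    let r' := zpexpmod r (Z.to_nat p) in
    nilp (zpred (zpsub (zpmulmod v (zpsub r' [:: 0; 1]%ZZ)) [:: 1]%ZZ)) && ben_or_check r' vs'
  else true.

Variable x : A.
Hypotheses (p_gt0 : (0 < p)%ZZ) (p0 : zr A p = 0) (fx0 : evz f x = 0).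

Lemma zr_mod c : zr A (c mod p) = zr A c.
Proof. by rewrite [in RHS](Z.div_mod c p); [rewrite zrD zrM p0 mul0r add0r|lia]. Qed.

Lemma evz_red a : evz (zpred a) x = evz a x.
Proof. by rewrite evz_trim; elim: a => //= c a ->; rewrite zr_mod. Qed.

Lemma evz_mulmod a b : evz (zpmulmod a b) x = evz a x * evz b x.
Proof. by rewrite evz_red evz_sub !evz_mul fx0 mulr0 subr0. Qed.

Lemma evz_expmod a n : evz (zpexpmod a n) x = evz a x ^+ n.
Proof.
elim: n => [|n IHn]; first by rewrite /= mulr0 addr0 zr1.
by rewrite exprS -IHn -evz_mulmod.
Qed.

(** If the power fixed [x], evaluating at [x] the certified congruence v (X^(p^j) - X) = 1 would
    give 0 = 1. Evaluation respects the congruence because [p] and [f] vanish there. *)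
Lemma ben_or_checkP r vs k :
    ben_or_check r vs -> evz r x = x ^+ (Z.to_nat p ^ k) ->
  forall d, (d < size vs)%N -> x ^+ (Z.to_nat p ^ (k + d.+1)) != x.
Proof.
elim: vs r k => //= v vs IHvs r k /andP[/nilP chk chks] rE.
have r'E : evz (zpexpmod r (Z.to_nat p)) x = x ^+ (Z.to_nat p ^ k.+1).
  by rewrite evz_expmod rE -exprM expnSr.
move=> [_|d lt_d]; last by rewrite -addSnnS; apply: IHvs chks r'E d lt_d.
rewrite addn1; apply/eqP => xE.
have /esym/eqP := congr1 (evz^~ x) chk.
rewrite evz_red evz_sub evz_mulmod evz_sub r'E xE /= !zr0 !zr1 !mulr0 !addr0 add0r mulr1.
by rewrite subrr mulr0 sub0r eq_sym oppr_eq0 oner_eq0.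
Qed.

End Modular.
End IntegerPolynomialLists.

(** Substitutes X^2 for X; no zero follows the last coefficient, so [last] still yields the leading
    one. *)
Fixpoint spread (l : seq Z) : seq Z :=
  if l is c :: l' then c :: (if l' is [::] then [::] else 0%ZZ :: spread l') else [::].

Lemma evz_spread (A : comNzRingType) l (x : A) : evz (spread l) x = evz l (x ^+ 2).
Proof.
elim: l => //= c [|d l] IHl; first by rewrite /= !mulr0.
by rewrite -IHl [evz (_ :: _) x]/= zr0 add0r mulrA expr2.
Qed.

(** The polynomial q with P_xA(X) = q(X^2), constant term first. *)
Definition harborth_coefs : seq Z :=
  [:: (-830376562500); 1358127000000; (-34144387143750); 96857243056800; (-68697978132015);
    (-189712941147); 6188723588664; (-704220643376); (-52577813248); 27196394496; (-2918612992);
    106774528]%ZZ.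

(* Inverses of X^(17^d) - X modulo 17 and P_xA, for d = 1, ..., 11. *)
Definition ben_or_certificate : seq (seq Z) := [::
  [:: 0; (-8); 0; 0; 0; (-4); 0; 1; 0; 7; 0; (-5); 0; 3; 0; 3; 0; 5; 0; (-3); 0; 5];
  [:: 0; (-4); 0; 0; 0; 8; 0; (-7); 0; (-6); 0; 6; 0; 0; 0; (-8); 0; (-2); 0; (-6); 0; (-8)];
  [:: 0; (-4); 0; (-5); 0; (-3); 0; 4; 0; (-8); 0; 6; 0; (-5); 0; (-7); 0; (-3); 0; (-5); 0; (-3)];
  [:: 0; (-5); 0; (-6); 0; (-3); 0; (-3); 0; (-6); 0; (-3); 0; (-7); 0; 0; 0; 2; 0; (-8); 0; (-5)];
  [:: 0; (-3); 0; (-1); 0; (-1); 0; 3; 0; (-1); 0; 4; 0; (-3); 0; (-2); 0; (-6); 0; (-8); 0; (-4)];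
  [:: 0; (-1); 0; (-4); 0; 6; 0; 0; 0; 5; 0; 7; 0; (-7); 0; 8; 0; (-3); 0; (-3); 0; 8];
  [:: 0; 1; 0; 8; 0; (-6); 0; (-7); 0; 8; 0; 1; 0; 8; 0; 7; 0; 5; 0; (-3); 0; 5];
  [:: 0; 7; 0; 3; 0; (-3); 0; (-6); 0; (-2); 0; (-8); 0; (-1); 0; (-6); 0; 6; 0; (-5); 0; (-8)];
  [:: 0; (-3); 0; (-2); 0; (-7); 0; 3; 0; 5; 0; 3; 0; 1; 0; 3; 0; (-2); 0; (-4); 0; (-1)];
  [:: 0; 6; 0; 8; 0; 8; 0; 1; 0; 8; 0; (-5); 0; (-7); 0; 3; 0; 7; 0; (-5); 0; 1];
  [:: 0; 5; 0; (-8); 0; (-1); 0; 3; 0; 3; 0; 8; 0; 0; 0; 0; 0; 4; 0; (-7); 0; (-5)]]%ZZ.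

(** Turns folded numerals into binary integers, so that large constants are compared in [Z] without
    becoming unary. *)
Lemma natr_zr (A : pzRingType) (n : Number.uint) :
  (Nat.of_num_uint n)%:R = zr A (Z.of_num_uint n).
Proof. by rewrite /zr (common.large_nat_Z_int (common.large_nat_uint n)). Qed.

Lemma natr_zr_eq (A : pzRingType) u z : Z.of_num_uint u = z -> (Nat.of_num_uint u)%:R = zr A z.
Proof. by move=> <-; apply: natr_zr. Qed.

(** The coefficients are variables, so that simplification never meets the large numerals. *)
Lemma even_poly_Poly (A : comNzRingType) (c0 c1 c2 c3 c4 c5 c6 c7 c8 c9 c10 c11 : A) :
  - c0%:P + c1 *: 'X^2 - c2 *: 'X^4 + c3 *: 'X^6 - c4 *: 'X^8 - c5 *: 'X^10 + c6 *: 'X^12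
    - c7 *: 'X^14 - c8 *: 'X^16 + c9 *: 'X^18 - c10 *: 'X^20 + c11 *: 'X^22
    = Poly [:: - c0; 0; c1; 0; - c2; 0; c3; 0; - c4; 0; - c5; 0; c6; 0; - c7; 0; - c8; 0;
      c9; 0; - c10; 0; c11].
Proof.
apply/polyP => i; rewrite coef_Poly !(coefD, coefN, coefZ, coefXn, coefC).
by do 23?[case: i => [|i]];
  rewrite /= ?nth_nil ?(mulr0, mulr1, subr0, addr0, add0r, sub0r, oppr0).
Qed.

Lemma P_xA_Poly : P_xA = Poly (map (zr rat) (spread harborth_coefs)).
Proof.
have neg u z : (- Z.of_num_uint u)%ZZ = z -> - (Nat.of_num_uint u)%:R = zr rat z.
  by move=> <-; rewrite zrN natr_zr.
have consE (a b : rat) l l' : a = b -> l = l' -> a :: l = b :: l' by move=> -> ->.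
rewrite /P_xA even_poly_Poly /harborth_coefs [spread _]/= [map _ _]/=.
apply: (congr1 (@Poly _)).
apply: (consE _ _ _ _); first by apply: neg; vm_compute.
apply: (consE _ _ _ _); first by rewrite zr0.
apply: (consE _ _ _ _); first by apply: natr_zr_eq; vm_compute.
apply: (consE _ _ _ _); first by rewrite zr0.
apply: (consE _ _ _ _); first by apply: neg; vm_compute.
apply: (consE _ _ _ _); first by rewrite zr0.
apply: (consE _ _ _ _); first by apply: natr_zr_eq; vm_compute.
apply: (consE _ _ _ _); first by rewrite zr0.
apply: (consE _ _ _ _); first by apply: neg; vm_compute.
apply: (consE _ _ _ _); first by rewrite zr0.
apply: (consE _ _ _ _); first by apply: neg; vm_compute.
apply: (consE _ _ _ _); first by rewrite zr0.
apply: (consE _ _ _ _); first by apply: natr_zr_eq; vm_compute.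
apply: (consE _ _ _ _); first by rewrite zr0.
apply: (consE _ _ _ _); first by apply: neg; vm_compute.
apply: (consE _ _ _ _); first by rewrite zr0.
apply: (consE _ _ _ _); first by apply: neg; vm_compute.
apply: (consE _ _ _ _); first by rewrite zr0.
apply: (consE _ _ _ _); first by apply: natr_zr_eq; vm_compute.
apply: (consE _ _ _ _); first by rewrite zr0.
apply: (consE _ _ _ _); first by apply: neg; vm_compute.
apply: (consE _ _ _ _); first by rewrite zr0.
apply: (consE _ _ _ _); first by apply: natr_zr_eq; vm_compute.
by [].
Qed.

Lemma size_lead_Poly_int_of_Z (s : seq Z) :
    last 0%ZZ s != 0%ZZ ->
  size (Poly (map int_of_Z s)) = size s /\
    lead_coef (Poly (map int_of_Z s)) = int_of_Z (last 0%ZZ s).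
Proof.
move=> last_neq0; have sK : Poly (map int_of_Z s) = map int_of_Z s :> seq int.
  apply: (@PolyK _ (int_of_Z 0)); rewrite last_map.
  by apply: contraNneq last_neq0 => h; rewrite -[last _ _]int_of_ZK h.
by split; [rewrite sK size_map|rewrite lead_coefE sK nth_last -[RHS]last_map].
Qed.

(** Multiplying by [inv] makes [s] monic modulo [p], as [zpdivmod] expects; the size bound provides
    a certificate for each d up to half the degree. *)
Lemma ben_or_irreducible (p : nat) (inv : Z) (s : seq Z) (vs : seq (seq Z)) :
    prime p -> ((inv * last 0 s) mod Z.of_nat p = 1)%ZZ ->
    (1 < size s <= (size vs).*2.+2)%N ->
    ben_or_check (Z.of_nat p) (zpred (Z.of_nat p) (zpscale inv s)) [:: 0; 1]%ZZ vs ->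
  irreducible_poly (Poly (map (zr rat) s)).
Proof.
move=> p_pr inv_lead /andP[s_gt1 s_le] chk.
have p_gt0 : (0 < Z.of_nat p)%ZZ by have := prime_gt0 p_pr; lia.
have intp (A : comNzRingType) : zr A (Z.of_nat p) = p%:R.
  by rewrite /zr (_ : int_of_Z _ = p%:Z) //; lia.
have Fp0 : zr 'F_p (Z.of_nat p) = 0 by rewrite intp pchar_Fp_0.
have lead_neq0 : zr 'F_p (last 0%ZZ s) != 0.
  have := zr_mod p_gt0 Fp0 (inv * last 0 s)%ZZ.
  rewrite inv_lead zrM zr1 => /esym/eqP; apply: contraTneq => ->.
  by rewrite mulr0 eq_sym oner_eq0.
have [|sizeE leadE] := @size_lead_Poly_int_of_Z s.
  by apply: contraNneq lead_neq0 => ->.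
rewrite (_ : Poly _ = map_poly intr (Poly (map int_of_Z s))); last first.
  by rewrite map_Poly -map_comp.
apply: (@irreducible_poly_reduction 'F_p); first by rewrite leadE.
have size_f : size (map_poly intr (Poly (map int_of_Z s)) : {poly 'F_p}) = size s.
  by rewrite size_map_poly_id0 ?leadE.
apply: irreducible_poly_finfield; rewrite size_f // => L z d fz d_gt0 d_lt.
have Lp0 : zr L (Z.of_nat p) = 0.
  by rewrite intp -(rmorph_nat (in_alg L)) pchar_Fp_0 // rmorph0.
have sz0 : evz s z = 0.
  move: fz; rewrite !map_Poly -!map_comp => /rootP.
  rewrite (_ : map _ _ = map (zr L) s) ?horner_Poly_evz //.
  by apply: eq_map => c /=; rewrite -in_algE rmorph_int.
have fz0 : evz (zpred (Z.of_nat p) (zpscale inv s)) z = 0.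
  by rewrite evz_red // evz_scale sz0 mulr0.
have r0 : evz [:: 0; 1]%ZZ z = z ^+ (Z.to_nat (Z.of_nat p) ^ 0).
  by rewrite /= zr0 zr1 mulr0 addr0 add0r mulr1 expr1.
have := ben_or_checkP p_gt0 Lp0 fz0 chk r0 (d := d.-1).
by rewrite card_Fp // add0n Nat2Z.id prednK //; apply; lia.
Qed.

Lemma irreducible_P_xA : irreducible_poly P_xA.
Proof.
(* The leading coefficient 106774528 is 10 modulo 17, with inverse 12. *)
rewrite P_xA_Poly; apply: (@ben_or_irreducible 17 12 _ ben_or_certificate).
- by [].
- by vm_compute.
- by vm_compute.
- by vm_compute.
Qed.

(** * The exact solution *)

Section IntegerBalls.
Variable R : realType.
Implicit Types (x : R) (l : seq Z).

Lemma ler_zr a b : (a <= b)%ZZ -> zr R a <= zr R b.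
Proof. by move=> le_ab; rewrite ler_int; lia. Qed.

Lemma ltr_zr a b : (a < b)%ZZ -> zr R a < zr R b.
Proof. by move=> lt_ab; rewrite ltr_int; lia. Qed.

Lemma normr_zr a : `|zr R a| = zr R (Z.abs a).
Proof. by rewrite /zr -intr_norm; congr (_%:~R); lia. Qed.

(* If [|s * x - m| <= r], then [zball s m r l] is a triple [(M, e, p)] with
   [p = s ^ size l] and [|p * l(x) - M| <= e]. *)
Fixpoint zball (s m r : Z) l : Z * Z * Z :=
  if l is c :: l' then
    let: (M, e, p) := zball s m r l' in
    (c * (s * p) + m * M, Z.abs m * e + r * (Z.abs M + e), s * p)%ZZ
  else (0, 0, 1)%ZZ.

(** Compares the upper bound (|M| + e) / p of |l(x)| with the lower bound (|M'| - e') / p' of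
    |l'(x)|, which the first test makes positive. *)
Definition zball_le s m r l l' : bool :=
  let: (M, e, p) := zball s m r l in let: (M', e', p') := zball s m r l' in
  Z.ltb e' (Z.abs M') && Z.leb ((Z.abs M + e) * p') ((Z.abs M' - e') * p).

Section Ball.
Variables (s m r : Z) (x : R).
Hypotheses (s_gt0 : (0 < s)%ZZ) (x_ball : `|zr R s * x - zr R m| <= zr R r).

Lemma zballP l : let: (M, e, p) := zball s m r l in
  (0 < p)%ZZ /\ `|zr R p * evz l x - zr R M| <= zr R e.
Proof.
elim: l => [|c l] /=; first by rewrite zr0 zr1 mul1r subr0 normr0.
case: (zball s m r l) => -[M e] p [p_gt0 IHl]; split; first by lia.
rewrite !(zrD, zrM) -!normr_zr.
(* Horner step: [m] times the previous error, plus the error on [s * x] times the previous value,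
   itself at most [|M| + e]. *)
rewrite (_ : _ - _ = zr R m * (zr R p * evz l x - zr R M)
  + (zr R s * x - zr R m) * (zr R p * evz l x)); last by ring.
apply: le_trans (ler_normD _ _) _; rewrite !normrM; apply: lerD.
  by apply: ler_wpM2l.
apply: ler_pM; rewrite // -?normrM //.
rewrite (_ : _ * _ = zr R M + (zr R p * evz l x - zr R M)); last by ring.
by apply: le_trans (ler_normD _ _) _; apply: lerD.
Qed.

Lemma zball_leP l l' :
  zball_le s m r l l' -> evz l' x != 0 /\ `|evz l x| <= `|evz l' x|.
Proof.
rewrite /zball_le; have := zballP l; have := zballP l'.
case: (zball s m r l) => -[M e] p; case: (zball s m r l') => -[M' e'] p'.
move=> [p'_gt0 b'] [p_gt0 b] /andP[/Z.ltb_lt lt_e /Z.leb_le /ler_zr].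
rewrite !zrM zrD zrD -!normr_zr zrN.
have {}p_gt0 : 0 < zr R p by rewrite -(zr0 R); apply: ltr_zr.
have {}p'_gt0 : 0 < zr R p' by rewrite -(zr0 R); apply: ltr_zr.
have {}lt_e : zr R e' < `|zr R M'| by rewrite normr_zr; apply: ltr_zr.
have up : zr R p * `|evz l x| <= `|zr R M| + zr R e.
  rewrite -[X in X * _](gtr0_norm p_gt0) -normrM.
  have -> : zr R p * evz l x = zr R M + (zr R p * evz l x - zr R M) by ring.
  by apply: le_trans (ler_normD _ _) _; apply: lerD.
have low : `|zr R M'| - zr R e' <= zr R p' * `|evz l' x|.
  rewrite -[X in X * _](gtr0_norm p'_gt0) -normrM lerBlDr.
  have {1}-> : zr R M' = zr R p' * evz l' x - (zr R p' * evz l' x - zr R M') by ring.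
  by apply: le_trans (ler_normB _ _) _; apply: lerD.
move=> chk; split.
  by apply: contraTneq low => ->; rewrite normr0 mulr0 -ltNge subr_gt0.
have : zr R p * zr R p' * `|evz l x| <= zr R p * zr R p' * `|evz l' x|.
  rewrite -mulrA [_ * `|evz l x|]mulrC mulrA -[leRHS]mulrA.
  apply: le_trans (ler_wpM2r (ltW p'_gt0) up) (le_trans chk _).
  by rewrite mulrC ler_wpM2l // ltW.
by rewrite ler_pM2l // mulr_gt0.
Qed.

End Ball.
End IntegerBalls.

(** * Coefficients of q' and of the numerators N, in ascending powers of w *)

Definition deriv_coefs : seq Z :=
  [:: 1358127000000; (-68288774287500); 290571729170400; (-274791912528060); (-948564705735);
    37132341531984; (-4929544503632); (-420622505984); 244767550464; (-29186129920); 1174519808]%ZZ.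

Definition num_t : seq Z :=
  [:: 591372044437500; 2105784762648750; (-6919874604359100); 3637809660012930; 268317764387559;
    (-277219741644648); 26746672566192; 3126548714496; (-722552896512); 31117615104; 320323584]%ZZ.
Definition num_T : seq Z :=
  [:: (-263635332187500); 23691270723750; 377140878370800; (-316416574700640); 209388907691343;
    (-71090017590216); 3612772397104; 2423002053632; (-758622956544); 79871418368; (-3096461312)]%ZZ.
Definition num_D1 : seq Z :=
  [:: (-890672972625000); 1159503099581250; (-1762803349510950); 395030243853585; 1076408966804823;
    (-458514949978296); 29630812070064; 12466783598592; (-3775079752704); 374980190208;
    (-13773914112)]%ZZ.
Definition num_D2 : seq Z :=
  [:: 491605068375000; 3194214050058750; (-9814100588982450); 4982089627968435; 716560008118353;
    (-522464638852296); 45539167444944; 8324326152192; (-2221763779584); 166483550208; (-4164206592)]%ZZ.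
Definition num_E1 : seq Z :=
  [:: (-790905996562500); 71073812171250; 1131422635112400; (-949249724101920); 628166723074029;
    (-213270052770648); 10838317191312; 7269006160896; (-2275868869632); 239614255104; (-9289383936)]%ZZ.
Definition num_E2 : seq Z :=
  [:: 64101380062500; 2153167304096250; (-6165592847617500); 3004976510611650; 687095579770245;
    (-419399776825080); 33972217360400; 7972552821760; (-2239798809600); 190860451840; (-5872599040)]%ZZ.
Definition num_F1 : seq Z :=
  [:: (-280047263625000); 4123401618116250; (-12456463547927700); 9311418741187035; 431402061590568;
    (-1217653371488736); 148890705183744; 16299372402432; (-7701724975104); 895813459968;
    (-34594947072)]%ZZ.
Definition num_F2 : seq Z :=
  [:: 505555394625000; 901456099143750; (-4962598696032300); 3549085246263015; (-17424780337728);
    (-357142535524704); 57954804578816; 3677708747008; (-1865919737856); 193021960192; (-8114864128)]%ZZ.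
Definition num_G1 : seq Z :=
  [:: 482947008750000; 4895011024773750; (-17601923140929900); 13783796831721420; 403985550830526;
    (-1637839486176912); 187888455890208; 17824198466304; (-9481416726528); 1075963355136;
    (-40360771584)]%ZZ.
Definition num_G2 : seq Z :=
  [:: 600351183000000; 2541818161023750; (-9170626342243500); 5751652186671300; 242066463021270;
    (-566326657440240); 71623634864160; 6639782250240; (-2698282629120); 266558300160; (-9609707520)]%ZZ.
Definition num_H2 : seq Z :=
  [:: (-140831865000000); 1000262142945000; (-1572803569903500); (-1327512386614050); 815524943556960;
    45266619953040; (-20547420755520); 4803346767360; 393145282560; (-133970657280); 6406471680]%ZZ.
Definition num_J2 : seq Z :=
  [:: 934450425000000; 2107441833412500; (-9639342315639000); 6886557761734350; 98612585961750;
    (-671827653826560); 84288095074720; 5921158530560; (-3171947059200); 319865077760;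
    (-11745198080)]%ZZ.
(** This numerator makes the common abscissa of [J] and [H] equal to [- x]. *)
Definition num_J1 : seq Z := zpscale (-30) deriv_coefs.

(* Quotient of the power series [a] by [q], exact when [q] divides [a]; only a
   guess that [bilinear_check] verifies. *)
Fixpoint zpquo n (a q : seq Z) : seq Z :=
  if n is n'.+1 then
    let c := (head 0 a / head 0 q)%ZZ in c :: zpquo n' (behead (zpsub a (zpscale c q))) q
  else [::].

(* Decides whether [w * (a1 * b1 + 3 * a2 * b2) = 900 * q'^2 * k / 2] modulo [q]. *)
Definition bilinear_check (a1 b1 a2 b2 : seq Z) (k : Z) : bool :=
  let a := zpsub (0%ZZ :: zpadd (zpmul a1 b1) (zpscale 3 (zpmul a2 b2)))
    (zpscale (450 * k) (zpmul deriv_coefs deriv_coefs)) in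
  nilp (zptrim (zpsub a (zpmul harborth_coefs (zpquo 11 a harborth_coefs)))).

(** After division by 30 [den] q'(x^2), this places the quotient x N(x^2) / (30 q'(x^2)) within
    [1 / den] of [c / den]. *)
Definition near_check (s m r : Z) (num : seq Z) (c den : Z) : bool :=
  zball_le s m r (zpsub (0%ZZ :: zpscale den (spread num)) (zpscale (30 * c) (spread deriv_coefs)))
    (zpscale 30 (spread deriv_coefs)).

Lemma rounding_bound (R : realType) (a b c d : R) :
    a <= 2 * 10 ^- 9 -> b <= 10 ^- 9 * (c / 10 ^+ 9) ->
    10 ^+ 6 * (2 * 10 ^+ 9 + c) + d <= 10 ^+ 18 ->
  a + b + d / 10 ^+ 24 <= 10 ^- 6.
Proof. by move=> *; lra. Qed.

Section ExactSolution.
Variable R : realType.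
Variables (x r3 : R).
Hypotheses (x_root : evz (spread harborth_coefs) x = 0) (r3_sqr : r3 ^+ 2 = 3).

(* The values at a root of P_xA of the formulas of the header; [r3] is sqrt 3. *)
Definition xcoord num : R := x * evz num (x ^+ 2) / (30 * evz deriv_coefs (x ^+ 2)).
Definition ycoord num : R := r3 * xcoord num.

Lemma xcoordB a b : xcoord (zpsub a b) = xcoord a - xcoord b.
Proof. by rewrite /xcoord evz_sub mulrBr mulrBl. Qed.

Lemma ycoordB a b : ycoord (zpsub a b) = ycoord a - ycoord b.
Proof. by rewrite /ycoord xcoordB mulrBr. Qed.

Lemma xcoordZ c a : xcoord (zpscale c a) = zr R c * xcoord a.
Proof. by rewrite /xcoord evz_scale mulrCA !mulrA. Qed.

Lemma ycoordZ c a : ycoord (zpscale c a) = zr R c * ycoord a.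
Proof. by rewrite /ycoord xcoordZ mulrCA. Qed.

Hypothesis deriv_neq0 : evz deriv_coefs (x ^+ 2) != 0.

Lemma xcoord_J : xcoord num_J1 = - x.
Proof.
rewrite xcoordZ /xcoord (_ : zr R (-30) = -30) //; field.
exact: deriv_neq0.
Qed.

(** Both products have denominator 900 q'^2, and [r3 ^+ 2 = 3] removes the square root. The
    right-hand side is a half-integer because one equation has 3/2. *)
Lemma bilinear_checkP a1 b1 a2 b2 k :
    bilinear_check a1 b1 a2 b2 k ->
  xcoord a1 * xcoord b1 + ycoord a2 * ycoord b2 = zr R k / 2.
Proof.
move=> /nilP /(congr1 (fun l => evz l (x ^+ 2))).
have q0 : evz harborth_coefs (x ^+ 2) = 0 by rewrite -evz_spread.
rewrite evz_trim evz_sub evz_mul q0 mul0r subr0 evz_sub evz_scale [evz (0%ZZ :: _) _]/=.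
rewrite evz_add evz_scale !evz_mul zrM zr0 add0r (_ : zr R 450 = 450) // (_ : zr R 3 = 3) //.
rewrite /ycoord /xcoord [evz [::] _]/=.
move: deriv_neq0; set d := evz deriv_coefs _ => d0.
set p1 := evz a1 _; set p2 := evz b1 _; set p3 := evz a2 _; set p4 := evz b2 _.
move=> /eqP; rewrite subr_eq0 => /eqP E.
rewrite (_ : _ + _ = x ^+ 2 * (p1 * p2 + r3 ^+ 2 * (p3 * p4)) / (900 * (d * d))); last first.
  by field.
by rewrite r3_sqr E; field.
Qed.

Variables (s m r : Z).
Hypotheses (s_gt0 : (0 < s)%ZZ) (x_ball : `|zr R s * x - zr R m| <= zr R r).

Lemma near_checkP num c den : (0 < den)%ZZ -> near_check s m r num c den ->
  `|xcoord num - zr R c / zr R den| <= (zr R den)^-1.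
Proof.
move=> den_gt0 /(zball_leP s_gt0 x_ball) [_].
rewrite evz_sub [evz (_ :: _) _]/= !evz_scale !evz_spread zrM zr0 add0r (_ : zr R 30 = 30) //.
rewrite /xcoord; move: deriv_neq0; set d := evz deriv_coefs _ => d0 le_d.
have {}den_gt0 : 0 < zr R den by rewrite -(zr0 R); apply: ltr_zr.
have den_neq0 : zr R den != 0 by rewrite gt_eqF.
rewrite (_ : _ - _ = (x * (zr R den * evz num (x ^+ 2)) - 30 * zr R c * d)
  / (30 * d * zr R den)); last by field; rewrite d0 den_neq0.
rewrite normrM normfV ler_pdivrMr ?normr_gt0 ?mulf_neq0 ?pnatr_eq0 //.
by rewrite normrM (gtr0_norm den_gt0) [leRHS]mulrCA mulVf // mulr1.
Qed.

Lemma xcoord_near num n c : n%:R = zr R c -> near_check s m r num c 1000000 ->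
  `|xcoord num - n%:R / 10 ^+ 6| <= 10 ^- 6.
Proof. by move=> ->; rewrite -(zr_pow10 R 6); apply: near_checkP. Qed.

Lemma xcoord_nearN num n c : n%:R = zr R c -> near_check s m r num (- c) 1000000 ->
  `|xcoord num - (- (n%:R / 10 ^+ 6))| <= 10 ^- 6.
Proof.
by move=> ->; rewrite -(zr_pow10 R 6) -mulNr -zrN; apply: near_checkP.
Qed.

(* [c3 / 10^9] approximates the quotient of the ordinate by sqrt 3. *)
Definition ynear_check num (c c3 : Z) : bool :=
  near_check s m r num c3 1000000000 &&
  Z.leb (1000000 * (2000000000 + Z.abs c3)
         + Z.abs (1732050808 * c3 * 1000000 - c * 1000000000000000000))
    1000000000000000000.

Hypothesis r3_near : `|r3 - zr R 1732050808 / 10 ^+ 9| <= 10 ^- 9.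
Hypothesis r3_le2 : `|r3| <= 2.

Lemma ycoord_near num n c c3 : n%:R = zr R c -> ynear_check num c c3 ->
  `|ycoord num - n%:R / 10 ^+ 6| <= 10 ^- 6.
Proof.
have pow6 : zr R 1000000 = 10 ^+ 6 := zr_pow10 R 6.
have pow9 : zr R 1000000000 = 10 ^+ 9 := zr_pow10 R 9.
have pow18 : zr R 1000000000000000000 = 10 ^+ 18 := zr_pow10 R 18.
have two_pow9 : zr R 2000000000 = 2 * 10 ^+ 9.
  by rewrite -pow9; apply: (zrM R 2 1000000000).
move=> -> /andP[/near_checkP near /Z.leb_le /(@ler_zr R)].
have {near} := near (erefl _); rewrite pow9.
rewrite !(zrD, zrM, zrN) -!normr_zr !(zrD, zrM, zrN) pow6 pow18 two_pow9.
rewrite /ycoord; move: (xcoord num) (zr R c) (zr R c3) (zr R 1732050808) r3_near => V a b rho.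
move=> near3 nearV bound.
(* Three errors: that of the abscissa-like factor, that of sqrt 3, and the exact rational
   discrepancy of the decimals, which [ynear_check] computes over 10^24. *)
rewrite (_ : _ - _ = r3 * (V - b / 10 ^+ 9) + (r3 - rho / 10 ^+ 9) * (b / 10 ^+ 9)
  + (rho * b * 10 ^+ 6 - a * 10 ^+ 18) / 10 ^+ 24); last by field.
apply: le_trans (ler_normD _ _) _; apply: le_trans (lerD (ler_normD _ _) (lexx _)) _.
have b1 : `|r3 * (V - b / 10 ^+ 9)| <= 2 * 10 ^- 9 by rewrite normrM ler_pM.
have b2 : `|(r3 - rho / 10 ^+ 9) * (b / 10 ^+ 9)| <= 10 ^- 9 * (`|b| / 10 ^+ 9).
  rewrite normrM [`|b / _|]normrM normfV.
  by rewrite (ger0_norm (exprn_ge0 _ (ler0n R 10))) ler_wpM2r // divr_ge0 ?exprn_ge0.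
rewrite [`|_ / 10 ^+ 24|]normrM normfV (ger0_norm (exprn_ge0 _ (ler0n R 10))).
exact: (rounding_bound b1 b2 bound).
Qed.

End ExactSolution.

(** Every quadratic equation equates a product of abscissas plus a product of ordinates with a
    constant, the form decided by [bilinear_check]. *)
Lemma exact_solution_system (R : realType) (x r3 : R) :
    evz (spread harborth_coefs) x = 0 -> r3 ^+ 2 = 3 -> evz deriv_coefs (x ^+ 2) != 0 ->
  harborth_system (xcoord x num_t) (ycoord x r3 num_T)
    (xcoord x num_D1, ycoord x r3 num_D2) (xcoord x num_E1, ycoord x r3 num_E2)
    (xcoord x num_F1, ycoord x r3 num_F2) (xcoord x num_G1, ycoord x r3 num_G2)
    (xcoord x num_J1, ycoord x r3 num_H2) (xcoord x num_J1, ycoord x r3 num_J2).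
Proof.
move=> x_root r3_sqr d_neq0.
have two : 2 = zr R 2 by [].
have mone a : - xcoord x a = xcoord x (zpscale (-1) a).
  by rewrite xcoordZ (_ : zr R (-1) = -1) // mulN1r.
have ymone a : - ycoord x r3 a = ycoord x r3 (zpscale (-1) a).
  by rewrite ycoordZ (_ : zr R (-1) = -1) // mulN1r.
have bil a1 b1 a2 b2 k := @bilinear_checkP R x r3 x_root r3_sqr d_neq0 a1 b1 a2 b2 k.
have dist a1 b1 a2 b2 k : bilinear_check (zpsub a1 b1) (zpsub a1 b1) (zpsub a2 b2) (zpsub a2 b2) k ->
    (xcoord x a1 - xcoord x b1) ^+ 2 + (ycoord x r3 a2 - ycoord x r3 b2) ^+ 2 = zr R k / 2.
  by rewrite -xcoordB -ycoordB !expr2; apply: bil.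
have sub2 a b : xcoord x a - 2 * xcoord x b = xcoord x (zpsub a (zpscale 2 b)).
  by rewrite xcoordB xcoordZ.
have k1 : zr R 2 / 2 = 1 by rewrite -two; field.
have km2 : zr R (-2) / 2 = -1 by rewrite (_ : zr R (-2) = -2) //; field.
have k4 : zr R 8 / 2 = 4 by rewrite (_ : zr R 8 = 8) //; field.
rewrite /harborth_system /sqdist; cbn [fst snd].
do ?[apply: conj].
- rewrite -k1 !expr2; apply: bil; vm_compute; exact: isT.
- rewrite mone sub2 -[3](_ : zr R 3 = 3) //; apply: bil; vm_compute; exact: isT.
- rewrite sub2 !expr2 (bil _ _ _ _ 18); last by vm_compute.
  by rewrite (_ : zr R 18 = 18) //; field.
- have chk : bilinear_check num_t (zpsub num_E1 num_t) (zpscale (-1) num_T) (zpsub num_E2 num_T) (-2).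
    by vm_compute.
  have := bil _ _ _ _ _ chk; rewrite xcoordB ycoordB -ymone mulNr => ->.
  by rewrite km2 addNr.
- rewrite -k4; apply: dist; vm_compute; exact: isT.
- rewrite -k1 !expr2; apply: bil; vm_compute; exact: isT.
- rewrite -k1; apply: dist; vm_compute; exact: isT.
- rewrite -k1; apply: dist; vm_compute; exact: isT.
- rewrite -k4; apply: dist; vm_compute; exact: isT.
- rewrite -k4; apply: dist; vm_compute; exact: isT.
- rewrite -k4; apply: dist; vm_compute; exact: isT.
- rewrite -k1; apply: dist; vm_compute; exact: isT.
- rewrite -k1; apply: dist; vm_compute; exact: isT.
- by [].
Qed.

(** * Isolation of the root, and comparison with the given solution *)

Lemma evz_ivt (R : rcfType) (l : seq Z) (a b : R) :
    a <= b -> 0 <= evz l a -> evz l b <= 0 ->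
  exists2 x, a <= x /\ x <= b & evz l x = 0.
Proof.
move=> le_ab la lb.
have [|x /andP[ax xb]] := @poly_ivt R (- Poly (map (zr R) l)) _ _ le_ab.
  by rewrite !hornerN !horner_Poly_evz oppr_le0 oppr_ge0 la.
by rewrite /root hornerN oppr_eq0 horner_Poly_evz => /eqP; exists x.
Qed.

Definition le0_check (s m : Z) l : bool :=
  let: (M, e, _) := zball s m 0 l in Z.leb (M + e) 0.

(** The checks evaluate at the rational points [(c - 1) / s] and [(c + 1) / s] with radius 0 and
    find a change of sign from nonnegative to nonpositive. *)
Lemma evz_root_near (R : realType) (s c : Z) (l : seq Z) :
    (0 < s)%ZZ -> le0_check s (c - 1) (zpscale (-1) l) -> le0_check s (c + 1) l ->
  exists2 x : R, evz l x = 0 & `|zr R s * x - zr R c| <= zr R 1.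
Proof.
move=> s_gt0 left_check right_check.
have zs_gt0 : 0 < zr R s by rewrite -(zr0 R); apply: ltr_zr.
pose pt m := zr R m / zr R s.
have ptE m : zr R s * pt m = zr R m by rewrite mulrC divfK // gt_eqF.
have sign_at m l' : le0_check s m l' -> evz l' (pt m) <= 0.
  have pt_ball : `|zr R s * pt m - zr R m| <= zr R 0 by rewrite ptE subrr normr0 zr0.
  rewrite /le0_check; have := zballP s_gt0 pt_ball l'.
  case: (zball _ _ _ _) => -[M e] p [p_gt0 /ler_normlP[_ le_e]] /Z.leb_le /(@ler_zr R).
  rewrite zrD zr0 => le0.
  have {}p_gt0 : 0 < zr R p by rewrite -(zr0 R); apply: ltr_zr.
  by rewrite -(pmulr_rle0 _ p_gt0) (le_trans _ le0) // -lerBlDl.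
have le_pt : pt (c - 1)%ZZ <= pt (c + 1)%ZZ.
  by apply: ler_wpM2r; [rewrite invr_ge0 ltW|apply: ler_zr; lia].
have left_sign : 0 <= evz l (pt (c - 1)%ZZ).
  have := sign_at _ _ left_check.
  by rewrite evz_scale (zrN R 1) zr1 mulN1r oppr_le0.
have [x [lx ux] x_root] := evz_ivt le_pt left_sign (sign_at _ _ right_check).
exists x => //; move: (ler_wpM2l (ltW zs_gt0) lx) (ler_wpM2l (ltW zs_gt0) ux).
rewrite !ptE !zrD zrN zr1; move: (zr R c) (_ * x) => c' y {}lx {}ux.
by apply/ler_normlP; split; lra.
Qed.

Lemma sqrt3_near (R : realType) :
  `|Num.sqrt 3 - zr R 1732050808 / 10 ^+ 9| <= 10 ^- 9 /\ `|Num.sqrt 3 : R| <= 2.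
Proof.
have r3_ge0 : 0 <= Num.sqrt 3 :> R := sqrtr_ge0 _.
have r3_sqr : Num.sqrt 3 ^+ 2 = 3 :> R by rewrite sqr_sqrtr.
have a_val : 1732050808%:R = zr R 1732050808 by exact: natr_zr_eq.
rewrite -a_val; move: (Num.sqrt 3) r3_ge0 r3_sqr => r r_ge0 r_sqr {a_val}.
split; last by rewrite ger0_norm //; nra.
have up : r <= 1732050808%:R / 10 ^+ 9.
  by rewrite -(@ler_pXn2r _ 2) ?nnegrE ?divr_ge0 ?exprn_ge0 ?ler0n // r_sqr; lra.
have low : 1732050807%:R / 10 ^+ 9 <= r.
  by rewrite -(@ler_pXn2r _ 2) ?nnegrE ?divr_ge0 ?exprn_ge0 ?ler0n // r_sqr; lra.
by apply/ler_normlP; split; lra.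
Qed.

Lemma harborth_approx_near (R : realType) (t T : R) D E F G H J :
  harborth_approx t T D E F G H J -> harborth_near (10 ^- 6) t T D E F G H J.
Proof.
rewrite /harborth_approx /harborth_near /approx15 /dec15.
case: D E F G H J => [D1 D2] [E1 E2] [F1 F2] [G1 G2] [H1 H2] [J1 J2]; cbn [fst snd].
case=> /ler_normlP[l u] h; split; first by clear h; apply/ler_normlP; split; lra.
move: h => {l u}.
case=> /ler_normlP[l u] h; split; first by clear h; apply/ler_normlP; split; lra.
move: h => {l u}.
case=> /ler_normlP[l u] h; split; first by clear h; apply/ler_normlP; split; lra.
move: h => {l u}.
case=> /ler_normlP[l u] h; split; first by clear h; apply/ler_normlP; split; lra.
move: h => {l u}.
case=> /ler_normlP[l u] h; split; first by clear h; apply/ler_normlP; split; lra.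
move: h => {l u}.
case=> /ler_normlP[l u] h; split; first by clear h; apply/ler_normlP; split; lra.
move: h => {l u}.
case=> /ler_normlP[l u] h; split; first by clear h; apply/ler_normlP; split; lra.
move: h => {l u}.
case=> /ler_normlP[l u] h; split; first by clear h; apply/ler_normlP; split; lra.
move: h => {l u}.
case=> /ler_normlP[l u] h; split; first by clear h; apply/ler_normlP; split; lra.
move: h => {l u}.
case=> /ler_normlP[l u] h; split; first by clear h; apply/ler_normlP; split; lra.
move: h => {l u}.
case=> /ler_normlP[l u] h; split; first by clear h; apply/ler_normlP; split; lra.
move: h => {l u}.
case=> /ler_normlP[l u] h; split; first by clear h; apply/ler_normlP; split; lra.
move: h => {l u}.
case=> /ler_normlP[l u] h; split; first by clear h; apply/ler_normlP; split; lra.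
move: h => {l u}.
move=> /ler_normlP[l u]; apply/ler_normlP; split; lra.
Qed.

(** A successful check separates its right-hand side, 30 q'(x^2), from 0, whatever [num] is. *)
Lemma near_check_deriv_neq0 (R : realType) (x : R) s m r num c den :
    (0 < s)%ZZ -> `|zr R s * x - zr R m| <= zr R r -> near_check s m r num c den ->
  evz deriv_coefs (x ^+ 2) != 0.
Proof.
move=> s_gt0 x_ball /(zball_leP s_gt0 x_ball) [+ _].
by rewrite evz_scale evz_spread; apply: contraNneq => ->; rewrite mulr0.
Qed.

Lemma exact_solution_near (R : realType) (x r3 : R) :
    `|zr R 1000000000000 * x - zr R 995049481192| <= zr R 1 ->
    `|r3 - zr R 1732050808 / 10 ^+ 9| <= 10 ^- 9 -> `|r3| <= 2 ->
    evz deriv_coefs (x ^+ 2) != 0 ->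
  harborth_near (10 ^- 6) (xcoord x num_t) (ycoord x r3 num_T)
    (xcoord x num_D1, ycoord x r3 num_D2) (xcoord x num_E1, ycoord x r3 num_E2)
    (xcoord x num_F1, ycoord x r3 num_F2) (xcoord x num_G1, ycoord x r3 num_G2)
    (xcoord x num_J1, ycoord x r3 num_H2) (xcoord x num_J1, ycoord x r3 num_J2).
Proof.
move=> x_ball r3_near r3_le2 d_neq0.
have s_gt0 : (0 < 1000000000000)%ZZ by [].
have xpos num n c := @xcoord_near R x d_neq0 _ _ _ s_gt0 x_ball num n c.
have xneg num n c := @xcoord_nearN R x d_neq0 _ _ _ s_gt0 x_ball num n c.
have ypos num n c c3 := @ycoord_near R x r3 d_neq0 _ _ _ s_gt0 x_ball r3_near r3_le2 num n c c3.
rewrite /harborth_near; cbn [fst snd].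
split; first by apply: (xpos _ _ 992686%ZZ); [exact: natr_zr_eq|by vm_compute].
(* The second integer given to [ypos] is 10^9 times the ordinate divided by sqrt 3,
   approximately. *)
split; first by apply: (ypos _ _ 120725%ZZ 69700806%ZZ); [exact: natr_zr_eq|by vm_compute].
split; first by apply: (xpos _ _ 809997%ZZ); [exact: natr_zr_eq|by vm_compute].
split; first by apply: (ypos _ _ 2760162%ZZ 1593580132%ZZ); [exact: natr_zr_eq|by vm_compute].
split; first by apply: (xpos _ _ 209102%ZZ); [exact: natr_zr_eq|by vm_compute].
split; first by apply: (ypos _ _ 1960833%ZZ 1132087561%ZZ); [exact: natr_zr_eq|by vm_compute].
split; first by apply: (xneg _ _ 61398%ZZ); [exact: natr_zr_eq|by vm_compute].
split; first by apply: (ypos _ _ 998113%ZZ 576261014%ZZ); [exact: natr_zr_eq|by vm_compute].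
split; first by apply: (xneg _ _ 838420%ZZ); [exact: natr_zr_eq|by vm_compute].
split; first by apply: (ypos _ _ 1627588%ZZ 939688117%ZZ); [exact: natr_zr_eq|by vm_compute].
split; first by apply: (xneg _ _ 995049%ZZ); [exact: natr_zr_eq|by vm_compute].
split; first by apply: (ypos _ _ 3621445%ZZ 2090842183%ZZ); [exact: natr_zr_eq|by vm_compute].
split; first by apply: (xneg _ _ 995049%ZZ); [exact: natr_zr_eq|by vm_compute].
by apply: (ypos _ _ 639930%ZZ 369463876%ZZ); [exact: natr_zr_eq|by vm_compute].
Qed.

Lemma algebraicOver_P_xA (R : realType) (x : R) :
  root (map_poly ratr P_xA) x -> algebraicOver (ratr : rat -> R) x.
Proof. by move=> rx; exists P_xA => //; apply: irredp_neq0 irreducible_P_xA. Qed.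

Theorem mainTheorem8 (R : realType) (t T : R) (D E F G H J : R * R)
    (hsys : harborth_system t T D E F G H J)
    (happrox : harborth_approx t T D E F G H J) :
  algebraicOver (ratr : rat -> R) (centered_x J (ptA R)) /\
  minimal_poly_rat (centered_x J (ptA R)) P_xA.
Proof.
(* The center is the prescribed [- x_J] cut to twelve decimals. *)
have [||x x_root x_ball] := @evz_root_near R 1000000000000%ZZ 995049481192%ZZ
  (spread harborth_coefs) (erefl _).
- by vm_compute.
- by vm_compute.
have d_neq0 : evz deriv_coefs (x ^+ 2) != 0.
  have chk : near_check 1000000000000 995049481192 1 num_J1 (-995049) 1000000
    by vm_compute.
  refine (near_check_deriv_neq0 _ x_ball chk).
  exact: erefl.
have [r3_near r3_le2] := sqrt3_near R.
have r3_sqr : Num.sqrt 3 ^+ 2 = 3 :> R by rewrite sqr_sqrtr.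
have J1E := harborth_unique hsys (exact_solution_system x_root r3_sqr d_neq0)
  (harborth_approx_near happrox) (exact_solution_near x_ball r3_near r3_le2 d_neq0).
have xE : centered_x J (ptA R) = x.
  by rewrite /centered_x J1E; cbn [fst snd ptA]; rewrite xcoord_J // sub0r opprK.
have root_x : root (map_poly ratr P_xA) x.
  apply/rootP; rewrite P_xA_Poly map_Poly -map_comp.
  rewrite (_ : map _ _ = map (zr R) (spread harborth_coefs)) ?horner_Poly_evz //.
  by apply: eq_map => c; rewrite /= /zr ratr_int.
rewrite xE; split; first exact: algebraicOver_P_xA.
by split=> //; apply: irreducible_P_xA.
Qed.
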